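(* Let $p^0=(p^0_i)_{i\in V}$ and $p^1=(p^1_i)_{i\in V}$ be elements of $\mathcal{P}_o(G)$, let $\beta>0$, and consider the discretized Schrödinger bridge problem: minimize $$F(m,p)=\sum_{l=1}^L\ \sum_{i+\frac{e_v}{2}\in E}\left\{\frac{m_{i+\frac{e_v}{2},l}^2}{(p_{i,l}+p_{i+e_v,l})/2}+\frac{\beta^2}{\Delta x^2}\left(\log p_{i,l}-\log p_{i+e_v,l}\right)^2\,\frac{p_{i,l}+p_{i+e_v,l}}{2}\right\}$$ over all $(m,p)\in\Theta$. Then the objective function $F$ is strictly convex for $(m,p)\in\mathrm{interior}(\Theta)$. Moreover, the minimizer $(m^*,p^* )\in\mathrm{interior}(\Theta)$ of the problem is unique (that is, the minimization problem over $\Theta$ has exactly one minimizer, and it lies in $\mathrm{interior}(\Theta)$).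
   Context: Spatial grid. Let $d,n\ge 1$ be integers, $\Delta x=\frac1n$, and let $G=(V,E)$ be the uniform lattice graph on $[0,1]^d$: the vertex set $V$ consists of the $N=(n+1)^d$ multi-indices $i=(i_1,\dots,i_d)$ with integers $0\le i_k\le n$; $e_v$ is the unit vector in the $v$-th coordinate direction; the edge set $E$ consists of the edges $i+\frac{e_v}{2}:=\mathrm{edge}(i,i+e_v)$ joining $i$ and $i+e_v$, for all $v\in\{1,\dots,d\}$ and all $i$ with both $i,i+e_v\in V$. A sum over $i+\frac{e_v}{2}\in E$ counts each edge once. Probability sets. $\mathcal{P}(G)=\{p=(p_i)_{i\in V}:\sum_{i\in V}p_i=1,\ p_i\ge 0 \text{ for all } i\in V\}$, and $\mathcal{P}_o(G)$ is its interior, the set of $p\in\mathcal{P}(G)$ with $p_i>0$ for all $i\in V$. Time grid. $L\ge 1$ is an integer, $\Delta t=\frac{1}{L+1}$, and $t_l=l\,\Delta t$ for $l=0,1,\dots,L+1$. The unknowns are $m=(m_{i+\frac{e_v}{2},l})\in\mathbb{R}^{|E|L}$ (one real number for each edge and each $l=1,\dots,L$) and $p=(p_{i,l})\in\mathbb{R}^{|V|L}$ (one real number for each vertex and each $l=1,\dots,L$). The boundary values are fixed: $p_{i,0}=p^0_i$ and $p_{i,L+1}=p^1_i$ for $i\in V$. Zero flux convention. $m_{i\pm\frac{e_v}{2},l}=0$ whenever $i\in V$ but $i\pm e_v\notin V$ (no flux leaves the lattice). Feasible set. $\Theta$ is the set of $(m,p)\in\mathbb{R}^{|E|L}\times\mathbb{R}^{|V|L}$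 such that, for all $i\in V$ and $l=1,\dots,L$, $p_{i,l}\ge 0$ and $$\frac{p_{i,l+1}-p_{i,l}}{\Delta t}+\frac{1}{\Delta x}\sum_{v=1}^d\left(m_{i+\frac12 e_v,l}-m_{i-\frac12 e_v,l}\right)=0,$$ with the boundary values $p_{i,0}=p^0_i$ and $p_{i,L+1}=p^1_i$ for $i\in V$, and with $m_{i\pm\frac{e_v}{2},l}=0$ whenever $i\in V$ but $i\pm e_v\notin V$. Its interior is defined as $$\mathrm{interior}(\Theta)=\{(m,p)\in\Theta:\ p_{i,l}>0 \text{ for all } i\in V,\ l=1,\dots,L\}.$$ Convention on the boundary. $F(m,p)=+\infty$ when $(m,p)\in\Theta\setminus\mathrm{interior}(\Theta)$. Strict convexity on the convex set $\mathrm{interior}(\Theta)$ is meant in the usual sense for points of this set. *)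

(* Defs.v *)
From HB Require Import structures.
From mathcomp Require Import all_boot all_order all_algebra.
From mathcomp Require Import all_classical all_reals all_analysis.

Set Implicit Arguments.
Unset Strict Implicit.
Unset Printing Implicit Defensive.

Import Order.TTheory GRing.Theory Num.Theory.

Local Open Scope classical_set_scope.
Local Open Scope ring_scope.

Definition vertex (d n : nat) : finType := {ffun 'I_d -> 'I_n.+1}.

(* i + e_v and i - e_v; both are meaningful only when the result is still a
   vertex, that is when i v < n, respectively 0 < i v. *)
Definition shift_up (d n : nat) (i : vertex d n) (v : 'I_d) : vertex d n :=
  [ffun w => inord (i w + (w == v))].
Definition shift_down (d n : nat) (i : vertex d n) (v : 'I_d) : vertex d n :=
  [ffun w => inord (i w - (w == v))].

(* The pair (i, v) with i v < n encodes the edge i + e_v/2 joining i and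
   i + e_v, so that each edge is represented exactly once. *)
Definition edge (d n : nat) : finType :=
  {iv : vertex d n * 'I_d | (iv.1 iv.2 < n)%N}.
Definition edge_tail (d n : nat) (e : edge d n) : vertex d n := (val e).1.
Definition edge_head (d n : nat) (e : edge d n) : vertex d n :=
  shift_up (val e).1 (val e).2.

(* R^o is R seen as a module over itself, which makes the space of unknowns an
   lmodType. The index l : 'I_L stands for the time t_(l+1), so that l ranges
   over t_1, ..., t_L. *)
Definition flux_space (R : realType) (d n L : nat) : lmodType R :=
  {ffun edge d n * 'I_L -> R^o}.
Definition density_space (R : realType) (d n L : nat) : lmodType R :=
  {ffun vertex d n * 'I_L -> R^o}.
Definition unknowns (R : realType) (d n L : nat) : lmodType R :=
  (flux_space R d n L * density_space R d n L)%type.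
Definition flux (R : realType) (d n L : nat) (x : unknowns R d n L)
    (e : edge d n) (l : 'I_L) : R := x.1 (e, l).
Definition density (R : realType) (d n L : nat) (x : unknowns R d n L)
    (i : vertex d n) (l : 'I_L) : R := x.2 (i, l).

Definition prob_simplex (R : realType) (d n : nat) :
    set {ffun vertex d n -> R} :=
  [set p | \sum_i p i = 1 /\ forall i, 0 <= p i].
Definition prob_simplex_int (R : realType) (d n : nat) :
    set {ffun vertex d n -> R} :=
  [set p | prob_simplex p /\ forall i, 0 < p i].

Definition space_step (R : realType) (n : nat) : R := n%:R^-1.
Definition time_step (R : realType) (L : nat) : R := (L.+1)%:R^-1.

(* m_(i + e_v/2, l) and m_(i - e_v/2, l), with value 0 when i + e_v,
   respectively i - e_v, is not a vertex (zero flux convention). *)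
Definition flux_up (R : realType) (d n L : nat) (x : unknowns R d n L)
    (i : vertex d n) (v : 'I_d) (l : 'I_L) : R :=
  if insub (i, v) is Some e then flux x e l else 0.
Definition flux_down (R : realType) (d n L : nat) (x : unknowns R d n L)
    (i : vertex d n) (v : 'I_d) (l : 'I_L) : R :=
  if (0 < i v)%N then flux_up x (shift_down i v) v l else 0.

(* p_(i, k) for a time index 0 <= k <= L + 1: the boundary values p0 and p1 at
   k = 0 and k = L + 1, the unknown density in between. *)
Definition density_at (R : realType) (d n L : nat)
    (p0 p1 : {ffun vertex d n -> R}) (x : unknowns R d n L)
    (i : vertex d n) (k : nat) : R :=
  if k is k'.+1 then (if insub k' is Some l then density x i l else p1 i)
  else p0 i.

(* The continuity equation is imposed at the times t_1, ..., t_L only, so it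
   involves p_(i, 1), ..., p_(i, L + 1) and never the boundary value p0. *)
Definition Theta (R : realType) (d n L : nat)
    (p0 p1 : {ffun vertex d n -> R}) : set (unknowns R d n L) :=
  [set x | forall (i : vertex d n) (l : 'I_L),
     0 <= density x i l /\
     (density_at p0 p1 x i l.+2 - density_at p0 p1 x i l.+1)
        / time_step R L
     + (space_step R n)^-1
        * \sum_(v < d) (flux_up x i v l - flux_down x i v l) = 0].

Definition Theta_int (R : realType) (d n L : nat)
    (p0 p1 : {ffun vertex d n -> R}) : set (unknowns R d n L) :=
  [set x | Theta p0 p1 x /\ forall i l, 0 < density x i l].

Definition objective_formula (R : realType) (d n L : nat) (beta : R)
    (x : unknowns R d n L) : R :=
  \sum_(l < L) \sum_(e : edge d n)
    (let q := density x (edge_tail e) l in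
     let r := density x (edge_head e) l in
     flux x e l ^+ 2 / ((q + r) / 2)
     + beta ^+ 2 / space_step R n ^+ 2
       * (ln q - ln r) ^+ 2 * ((q + r) / 2)).

(* On Theta, the positivity test singles out exactly Theta_int. *)
Definition objective (R : realType) (d n L : nat) (beta : R)
    (x : unknowns R d n L) : \bar R :=
  if [forall i, forall l, 0 < density x i l] then (objective_formula beta x)%:E
  else +oo%E.

Definition strictly_convex_on (R : realType) (E : lmodType R) (A : set E)
    (f : E -> \bar R) : Prop :=
  convex_set A /\
  forall (x y : E) (t : R), A x -> A y -> x <> y -> 0 < t -> t < 1 ->
    (f (t *: x + (1 - t) *: y)%R < t%:E * f x + (1 - t)%:E * f y)%E.

Definition minimizer_on (T : Type) (R : realType) (A : set T)
    (f : T -> \bar R) (x : T) : Prop :=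
  A x /\ forall y, A y -> (f x <= f y)%E.

(* Main.v *)
Require Import Defs.
From HB Require Import structures.
From mathcomp Require Import all_boot all_order all_algebra.
From mathcomp Require Import all_classical all_reals all_analysis.
From mathcomp Require Import ring lra.
Import Order.TTheory GRing.Theory Num.Theory.
Import numFieldNormedType.Exports.
Local Open Scope classical_set_scope.
Local Open Scope ring_scope.
Set Implicit Arguments.
Unset Strict Implicit.

(** The objective is a sum, over edges and times, of a function of the flux [m]
through the edge and of the densities [p] and [q] at its ends.  Each such edge
cost is positively homogeneous of degree one, and it is strictly convex except
along rays from the origin: its kinetic part is the perspective of the square,
and its logarithmic part is the perspective of
[s |-> (s + 1) / 2 * (ln s) ^ 2], whose derivative is strictly increasing on
the positive half-line ([edge_cost_convex]).

So if the convexity inequality of the whole sum is an equality between two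
points of the interior, then on each edge and at each time the triples
[(m, p, q)] of the two points are proportional.  As the grid is connected
([grid_connected]), the two densities at a given time are proportional; as the
continuity equation conserves mass and the terminal density has mass one
([mass_density]), they are equal.  Proportionality of the triples then makes
the fluxes equal as well.  This is strict convexity
([objective_formula_strictly_convex]), and uniqueness follows by comparing two
minimizers with their midpoint.

For existence, the set of points where the objective is at most its value at
the competitor with zero flux and constant density [p1] must be shown to stay
inside a compact part of the interior ([sublevel_bounds]).  Fluxes and
densities are bounded since densities are at most one.  The logarithmic part
gives a Harnack inequality: at an end of an edge where the density is not
small, the difference of logarithms is bounded, so the density is not small at
the other end either.  Some vertex carries at least the mean mass, and by
connectedness this lower bound propagates to all vertices ([harnack]).  The
objective is continuous on the resulting compact set, hence has a minimum
there. *)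

(** * Strict convexity of the edge cost *)

(** The logarithmic part of the cost of an edge with end densities [p] and [q]
is [q * profile (p / q)]. *)
Definition profile (R : realType) (s : R) : R := (s + 1) / 2 * ln s ^+ 2.
Definition profile' (R : realType) (s : R) : R :=
  ln s ^+ 2 / 2 + (1 + s^-1) * ln s.

Lemma is_derive_profile (R : realType) (s : R) : 0 < s ->
  is_derive s 1 (@profile R) (profile' s).
Proof.
move=> s0; have dl := is_derive1_ln s0.
rewrite /profile.
apply: is_derive_eq.
rewrite /profile' /GRing.scale /=; field; lra.
Qed.

Lemma is_derive_profile' (R : realType) (s : R) : 0 < s ->
  is_derive s 1 (@profile' R) (((s - 1) * ln s + s + 1) / s ^+ 2).
Proof.
move=> s0; have dl := is_derive1_ln s0.
have s_neq0 : s != 0 by rewrite gt_eqF.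
have dV := is_deriveV s_neq0 (is_derive_id s 1).
rewrite /profile'.
apply: is_derive_eq.
rewrite /GRing.scale /=; field; lra.
Qed.

(** Profile and derivative are differentiable only on the positive half-line,
which contains every segment between two positive points. *)
Lemma MVT_pos (R : realType) (f df : R -> R) (a b : R) : 0 < a -> a < b ->
  (forall x : R, 0 < x -> is_derive x 1 f (df x)) ->
  exists2 c, a < c < b & f b - f a = df c * (b - a).
Proof.
move=> a0 ab fd; have [|| c ci ->] := @MVT R f df a b ab.
- by move=> x; rewrite in_itv /= => /andP[ax _]; apply: fd; apply: lt_trans ax.
- apply: derivable_within_continuous => x; rewrite in_itv /= => /andP[ax _].
  by have := fd _ (lt_le_trans a0 ax) => ?; apply: ex_derive.
- by exists c; rewrite // -in_itv.
Qed.

(** The second derivative is a positive multiple of [(s - 1) * ln s + s + 1],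
where [s - 1] and [ln s] have the same sign. *)
Lemma profile'_incr (R : realType) (a b : R) : 0 < a -> a < b ->
  profile' a < profile' b.
Proof.
move=> a0 ab.
have [c /andP[ac _] e] := MVT_pos a0 ab (@is_derive_profile' R).
rewrite -subr_gt0 e mulr_gt0 ?subr_gt0 //.
have c0 : 0 < c by apply: lt_trans ac.
rewrite divr_gt0 ?exprn_gt0 //.
suff : 0 <= (c - 1) * ln c by lra.
have [c1|/ltW c1] := leP 1 c.
  by rewrite mulr_ge0 ?subr_ge0 ?ln_ge0.
by rewrite mulr_le0 ?subr_le0 ?ln_le0.
Qed.

(** By the mean value theorem the slope of the chord is the derivative at an
intermediate point, and the derivative is strictly increasing. *)
Lemma profile_tangent (R : realType) (s u : R) : 0 < s -> 0 < u -> s != u ->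
  profile u + profile' u * (s - u) < profile s.
Proof.
move=> s0 u0; rewrite neq_lt => /orP[su|us].
  have [c /andP[sc cu] e] := MVT_pos s0 su (@is_derive_profile R).
  have := profile'_incr (lt_trans s0 sc) cu; nra.
have [c /andP[uc cs] e] := MVT_pos u0 us (@is_derive_profile R).
have := profile'_incr u0 uc; nra.
Qed.

Definition edge_cost (R : realType) (k m p q : R) : R :=
  m ^+ 2 / ((p + q) / 2) + k * (ln p - ln q) ^+ 2 * ((p + q) / 2).

Lemma edge_cost_ge0 (R : realType) (k m p q : R) :
  0 <= k -> 0 < p -> 0 < q -> 0 <= edge_cost k m p q.
Proof.
move=> k0 p0 q0; have pq0 : 0 <= (p + q) / 2 by lra.
apply: addr_ge0; first by rewrite divr_ge0 ?sqr_ge0.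
by apply: mulr_ge0 => //; apply: mulr_ge0; rewrite ?sqr_ge0.
Qed.

Lemma leif_pM2l (R : numDomainType) (k x y : R) (C : bool) :
  0 < k -> x <= y ?= iff C -> k * x <= k * y ?= iff C.
Proof. by move=> k0; rewrite (mono_leif (ler_pM2l k0)). Qed.

(** The difference of the two sides is [(m - r * w) ^ 2 / w].  The left-hand
side is linear in [(m, w)]: it is the tangent of [m ^ 2 / w] along the ray of
slope [r]. *)
Lemma kinetic_tangent (R : realType) (m w r : R) : 0 < w ->
  2 * r * m - r ^+ 2 * w <= m ^+ 2 / w ?= iff (m == r * w).
Proof.
move=> w0.
have e : m ^+ 2 / w - (2 * r * m - r ^+ 2 * w) = (m - r * w) ^+ 2 / w.
  by field; rewrite gt_eqF.
split; first by rewrite -subr_ge0 e divr_ge0 ?sqr_ge0 ?(ltW w0).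
by rewrite eq_sym -subr_eq0 e mulf_eq0 sqrf_eq0 invr_eq0 (gt_eqF w0) orbF subr_eq0.
Qed.

(** The tangent of the profile at [u], multiplied by [q]: a linear minorant that
touches the logarithmic term exactly along the ray [p = u * q]. *)
Lemma log_term_tangent (R : realType) (p q u : R) :
  0 < p -> 0 < q -> 0 < u ->
  profile' u * p + (profile u - u * profile' u) * q
    <= (ln p - ln q) ^+ 2 * ((p + q) / 2) ?= iff (p == u * q).
Proof.
move=> p0 q0 u0; have qn0 : q != 0 by rewrite gt_eqF.
have -> : (ln p - ln q) ^+ 2 * ((p + q) / 2) = q * profile (p / q).
  by rewrite /profile ln_div //; field.
have -> : profile' u * p + (profile u - u * profile' u) * q
        = q * (profile u + profile' u * (p / q - u)) by field.
have -> : (p == u * q) = (p / q == u) by rewrite (can2_eq (divfK qn0) (mulfK qn0)).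
have [->|pqu] := eqVneq (p / q) u.
  by rewrite subrr mulr0 addr0; apply: leif_refl.
have lt := profile_tangent (divr_gt0 p0 q0) u0 pqu.
by split; rewrite ?ler_pM2l // ?(ltW lt) // (inj_eq (mulfI qn0)) lt_eqF.
Qed.

(** By homogeneity, the tangent at a point is a linear form without constant
term, and it touches the cost along the whole ray through the point. *)
Lemma edge_cost_tangent (R : realType) (k m0 p0 q0 : R) :
  0 < k -> 0 < p0 -> 0 < q0 -> exists a b c, forall m p q, 0 < p -> 0 < q ->
  a * m + b * p + c * q <= edge_cost k m p q
    ?= iff (p * q0 == p0 * q) && (m * (p0 + q0) == m0 * (p + q)).
Proof.
move=> k0 p0_gt0 q0_gt0.
pose u := p0 / q0; pose r := m0 / ((p0 + q0) / 2).
exists (2 * r), (k * profile' u - r ^+ 2 / 2),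
  (k * (profile u - u * profile' u) - r ^+ 2 / 2) => m p q p_gt0 q_gt0.
have w_gt0 : 0 < (p + q) / 2 by lra.
have q0_neq0 : q0 != 0 by rewrite gt_eqF.
have e1 : (p == p0 / q0 * q) = (p * q0 == p0 * q).
  by rewrite mulrAC (can2_eq (mulfK q0_neq0) (divfK q0_neq0)).
have e2 : (m == r * ((p + q) / 2)) = (m * (p0 + q0) == m0 * (p + q)).
  have w0_neq0 : p0 + q0 != 0 by rewrite gt_eqF ?addr_gt0.
  have -> : r * ((p + q) / 2) = m0 * (p + q) / (p0 + q0) by rewrite /r; field.
  by rewrite (can2_eq (mulfK w0_neq0) (divfK w0_neq0)).
rewrite -e1 -e2.
have := leifD (kinetic_tangent m r w_gt0) (leif_pM2l k0
  (log_term_tangent p_gt0 q_gt0 (divr_gt0 p0_gt0 q0_gt0))).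
rewrite andbC /edge_cost mulrA; congr (_ <= _ ?= iff _); rewrite /u; ring.
Qed.

(** The tangent at the intermediate point is linear and lies below the cost at
both ends.  Equality means that both ends lie on the ray of the intermediate
point, that is, that they are proportional to each other. *)
Lemma edge_cost_convex (R : realType) (k t m p q m' p' q' : R) :
  0 < k -> 0 < t -> t < 1 -> 0 < p -> 0 < q -> 0 < p' -> 0 < q' ->
  edge_cost k (t * m + (1 - t) * m') (t * p + (1 - t) * p')
              (t * q + (1 - t) * q')
    <= t * edge_cost k m p q + (1 - t) * edge_cost k m' p' q'
    ?= iff (p * q' == p' * q) && (m * (p' + q') == m' * (p + q)).
Proof.
move=> k0 t0 t1 p_gt0 q_gt0 p'_gt0 q'_gt0.
have s0 : 0 < 1 - t by lra.
set m2 := t * m + _; set p2 := t * p + _; set q2 := t * q + _.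
have p2_gt0 : 0 < p2 by rewrite addr_gt0 ?mulr_gt0.
have q2_gt0 : 0 < q2 by rewrite addr_gt0 ?mulr_gt0.
have [a [b [c T]]] := edge_cost_tangent m2 k0 p2_gt0 q2_gt0.
have [_] := T m2 p2 q2 p2_gt0 q2_gt0; rewrite !eqxx => /eqP <-.
have := leifD (leif_pM2l t0 (T m p q p_gt0 q_gt0))
              (leif_pM2l s0 (T m' p' q' p'_gt0 q'_gt0)).
(* a cross product with a point of the segment is a multiple of the cross
   product of the two ends *)
have cross (f x y z w : R) : f != 0 -> x - y = f * (z - w) -> (x == y) = (z == w).
  by move=> c0 e; rewrite -subr_eq0 e mulf_eq0 (negPf c0) subr_eq0.
have t_neq0 : t != 0 by rewrite gt_eqF.
have nt_neq0 : - t != 0 by rewrite oppr_eq0.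
have s_neq0 : 1 - t != 0 by rewrite gt_eqF.
rewrite (cross _ (p * q2) _ (p * q') (p' * q) s_neq0); last first.
  by rewrite /p2 /q2; ring.
rewrite (cross _ (p' * q2) _ (p * q') (p' * q) nt_neq0); last first.
  by rewrite /p2 /q2; ring.
rewrite (cross _ (m * (p2 + q2)) _ (m * (p' + q')) (m' * (p + q)) s_neq0);
  last by rewrite /m2 /p2 /q2; ring.
rewrite (cross _ (m' * (p2 + q2)) _ (m * (p' + q')) (m' * (p + q)) nt_neq0);
  last by rewrite /m2 /p2 /q2; ring.
by rewrite andbb; congr (_ <= _ ?= iff _); rewrite /m2 /p2 /q2; ring.
Qed.

(** * Geometry of the grid and conservation of mass *)

Lemma edge_exists (d n : nat) (i : vertex d n) (v : 'I_d) : (i v < n)%N ->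
  exists e : edge d n, edge_tail e = i /\ edge_head e = shift_up i v.
Proof. by move=> iv; exists (Sub (i, v) iv). Qed.

Lemma shift_up_self (d n : nat) (i : vertex d n) (v : 'I_d) : (i v < n)%N ->
  shift_up i v v = (i v).+1 :> nat.
Proof. by move=> iv; rewrite ffunE eqxx addn1 inordK. Qed.

Lemma shift_down_self (d n : nat) (i : vertex d n) (v : 'I_d) :
  shift_down i v v = (i v).-1 :> nat.
Proof.
by rewrite ffunE eqxx subn1 inordK // (leq_ltn_trans (leq_pred _)).
Qed.

Lemma shift_downK (d n : nat) (i : vertex d n) (v : 'I_d) : (0 < i v)%N ->
  shift_up (shift_down i v) v = i.
Proof.
move=> iv; apply/ffunP => w; apply: val_inj; rewrite /= !ffunE.
have := ltn_ord (i w); have [->|_] := eqVneq w v => iw.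
  by rewrite subn1 addn1 !inordK ?prednK // ltnW // prednK.
by rewrite subn0 addn0 !inordK.
Qed.

Lemma shift_upK (d n : nat) (i : vertex d n) (v : 'I_d) : (i v < n)%N ->
  shift_down (shift_up i v) v = i.
Proof.
move=> iv; apply/ffunP => w; apply: val_inj; rewrite /= !ffunE.
have := ltn_ord (i w); have [->|_] := eqVneq w v => iw.
  by rewrite addn1 subn1 !inordK.
by rewrite subn0 addn0 !inordK.
Qed.

Lemma shift_down_lt (d n : nat) (i : vertex d n) (v : 'I_d) : (0 < i v)%N ->
  (shift_down i v v < n)%N.
Proof. by move=> iv; rewrite shift_down_self -ltnS prednK. Qed.

(** Connectedness as an induction principle for relations: each vertex is
linked to the origin by lowering one positive coordinate at a time.  The
relation need not be symmetric, so that it may express how a lower bound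
propagates from one vertex to another. *)
Lemma grid_connected (d n : nat) (Q : vertex d n -> vertex d n -> Prop) :
  (forall i, Q i i) -> (forall j i k, Q i j -> Q j k -> Q i k) ->
  (forall e, Q (edge_tail e) (edge_head e)) ->
  (forall e, Q (edge_head e) (edge_tail e)) ->
  forall i j, Q i j.
Proof.
move=> Qxx Qtrans Qth Qht.
suff Q0 i : Q i [ffun=> ord0] /\ Q [ffun=> ord0] i.
  by move=> i j; exact: (Qtrans _ _ _ (Q0 i).1 (Q0 j).2).
have [s] := ubnP (\sum_v i v)%N; elim: s i => // s IHs i; rewrite ltnS => le_s.
have [/existsP[v iv]|/existsPn i0] := boolP [exists v, (0 < i v)%N]; last first.
  suff -> : i = [ffun=> ord0] by split.
  apply/ffunP => v; apply: val_inj; rewrite /= ffunE /=.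
  by apply/eqP; rewrite -leqn0 leqNgt i0.
have [] := IHs (shift_down i v).
  apply: leq_trans le_s; rewrite (bigD1 v) //= [leqRHS](bigD1 v) //=.
  rewrite shift_down_self -addSn prednK // leq_add2l leq_sum // => w wv.
  by rewrite ffunE (negPf wv) subn0 inordK.
have [e [te he]] := edge_exists (shift_down_lt iv).
rewrite shift_downK // in he.
by split; apply: (Qtrans (shift_down i v)); rewrite // -?te -?he.
Qed.

(** In each direction the outgoing fluxes and the incoming fluxes are the same
edge fluxes, indexed by the tails and by the heads of the edges. *)
Lemma sum_divergence0 (R : realType) (d n L : nat) (x : unknowns R d n L)
    (l : 'I_L) :
  \sum_i \sum_(v < d) (flux_up x i v l - flux_down x i v l) = 0.
Proof.
rewrite exchange_big /= big1 // => v _; rewrite sumrB; apply/eqP.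
rewrite subr_eq0; apply/eqP.
rewrite (bigID (fun i : vertex d n => (i v < n)%N)) /= [X in _ + X]big1; last first.
  by move=> i iv; rewrite /flux_up insubF //; apply/negbTE.
rewrite addr0 [RHS](bigID (fun i : vertex d n => (0 < i v)%N)) /=.
rewrite [X in _ = _ + X]big1; last by move=> i /negbTE iv; rewrite /flux_down iv.
rewrite addr0 (reindex_onto (fun i => shift_down i v) (fun i => shift_up i v)) /=.
  apply: eq_big => [i|i].
    apply/andP/idP => [[iv /eqP <-]|iv]; first by rewrite shift_up_self.
    by rewrite shift_down_lt // shift_downK.
  move=> /andP[iv /eqP e]; rewrite /flux_down.
  by rewrite -e shift_up_self //= e.
by move=> i iv; rewrite shift_upK.
Qed.

(** Backward induction from the final time, where the density is [p1]: the
continuity equation at a time conserves the mass up to the next time. *)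
Lemma mass1 (R : realType) (d n L : nat) (p0 p1 : {ffun vertex d n -> R})
    (x : unknowns R d n L) (k : nat) :
  \sum_i p1 i = 1 -> Theta p0 p1 x -> (k <= L)%N ->
  \sum_i density_at p0 p1 x i k.+1 = 1.
Proof.
move=> p1_sum xT kL; rewrite -(subKn kL).
elim: (L - k)%N (leq_subr k L) => [|j IHj] jL.
  by rewrite subn0 -p1_sum; apply: eq_bigr => i _ /=; rewrite insubF ?ltnn.
have lL : (L - j.+1 < L)%N by rewrite ltn_subrL (leq_ltn_trans _ jL).
rewrite -(IHj (ltnW jL)) -(subnSK jL).
have e i := (xT i (Ordinal lL)).2.
have := @big1 R 0 +%R _ (index_enum (vertex d n)) xpredT _ (fun i _ => e i).
rewrite big_split /= -mulr_sumr sum_divergence0 mulr0 addr0 -mulr_suml.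
rewrite sumrB => /eqP.
rewrite mulf_eq0 invr_eq0 /time_step invr_eq0 pnatr_eq0 orbF subr_eq0.
by move=> /eqP.
Qed.

Lemma mass_density (R : realType) (d n L : nat) (p0 p1 : {ffun vertex d n -> R})
    (x : unknowns R d n L) (l : 'I_L) :
  \sum_i p1 i = 1 -> Theta p0 p1 x -> \sum_i density x i l = 1.
Proof.
move=> p1_sum xT; rewrite -(mass1 p1_sum xT (ltnW (ltn_ord l))).
by apply: eq_bigr => i _; rewrite /density_at valK.
Qed.

(** * Strict convexity of the objective *)

Lemma density_conv (R : realType) (d n L : nat) (x y : unknowns R d n L)
    (t : R) i l :
  density (t *: x + (1 - t) *: y) i l = t * density x i l + (1 - t) * density y i l.
Proof. by rewrite /density /= !ffunE. Qed.

Lemma flux_conv (R : realType) (d n L : nat) (x y : unknowns R d n L)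
    (t : R) e l :
  flux (t *: x + (1 - t) *: y) e l = t * flux x e l + (1 - t) * flux y e l.
Proof. by rewrite /flux /= !ffunE. Qed.

Lemma flux_up_conv (R : realType) (d n L : nat) (x y : unknowns R d n L)
    (t : R) i v l :
  flux_up (t *: x + (1 - t) *: y) i v l
  = t * flux_up x i v l + (1 - t) * flux_up y i v l.
Proof.
by rewrite /flux_up; case: insub => [e|]; rewrite ?flux_conv // !mulr0 addr0.
Qed.

Lemma flux_down_conv (R : realType) (d n L : nat) (x y : unknowns R d n L)
    (t : R) i v l :
  flux_down (t *: x + (1 - t) *: y) i v l
  = t * flux_down x i v l + (1 - t) * flux_down y i v l.
Proof.
by rewrite /flux_down; case: ifP => _; rewrite ?flux_up_conv // !mulr0 addr0.
Qed.

Lemma density_at_conv (R : realType) (d n L : nat)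
    (p0 p1 : {ffun vertex d n -> R}) (x y : unknowns R d n L) (t : R) i k :
  density_at p0 p1 (t *: x + (1 - t) *: y) i k
  = t * density_at p0 p1 x i k + (1 - t) * density_at p0 p1 y i k.
Proof.
case: k => [|k] /=; first by ring.
by case: insub => [l|]; rewrite ?density_conv //; ring.
Qed.

Lemma conv_gt0 (R : realType) (t a b : R) :
  0 <= t <= 1 -> 0 < a -> 0 < b -> 0 < t * a + (1 - t) * b.
Proof. by move=> /andP[t0 t1] a0 b0; nra. Qed.

Lemma Theta_int_conv (R : realType) (d n L : nat)
    (p0 p1 : {ffun vertex d n -> R}) (x y : unknowns R d n L) (t : R) :
  0 <= t <= 1 -> Theta_int p0 p1 x -> Theta_int p0 p1 y ->
  Theta_int p0 p1 (t *: x + (1 - t) *: y).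
Proof.
move=> t01 [xT x0] [yT y0].
have pos i l : 0 < density (t *: x + (1 - t) *: y) i l.
  by rewrite density_conv conv_gt0.
split=> // i l; split; first exact: ltW.
have [_ ex] := xT i l; have [_ ey] := yT i l.
set z := t *: x + _.
have -> : \sum_(v < d) (flux_up z i v l - flux_down z i v l)
    = t * \sum_(v < d) (flux_up x i v l - flux_down x i v l)
      + (1 - t) * \sum_(v < d) (flux_up y i v l - flux_down y i v l).
  rewrite !mulr_sumr -big_split; apply: eq_bigr => v _.
  by rewrite flux_up_conv flux_down_conv /=; ring.
move: ex ey; move: (\sum_(v < d) _) (\sum_(v < d) _) => Sy Sx ex ey.
transitivity (t * 0 + (1 - t) * 0 : R); last by ring.
rewrite !density_at_conv -[in X in _ = X + _]ex -[in X in _ = _ + X]ey; ring.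
Qed.

Lemma convex_Theta_int (R : realType) (d n L : nat)
    (p0 p1 : {ffun vertex d n -> R}) : convex_set (@Theta_int R d n L p0 p1).
Proof.
move=> x y t; rewrite !inE => xT yT.
by apply: Theta_int_conv => //; rewrite ge0 le1.
Qed.

Lemma objective_int (R : realType) (d n L : nat) (beta : R)
    (x : unknowns R d n L) : (forall i l, 0 < density x i l) ->
  objective beta x = (objective_formula beta x)%:E.
Proof.
move=> x0; rewrite /objective ifT //.
by apply/forallP => i; apply/forallP.
Qed.

Lemma objective_formulaE (R : realType) (d n L : nat) (beta : R)
    (x : unknowns R d n L) :
  objective_formula beta x = \sum_(el : edge d n * 'I_L)
    edge_cost (beta ^+ 2 / space_step R n ^+ 2) (flux x el.1 el.2)
      (density x (edge_tail el.1) el.2) (density x (edge_head el.1) el.2).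
Proof.
by rewrite /objective_formula exchange_big pair_bigA.
Qed.

(** Connectedness propagates the proportionality from edges to all pairs of
vertices; equal total masses then force the ratio to be one. *)
Lemma density_eq_of_proportional (R : realType) (d n : nat)
    (f g : vertex d n -> R) :
  (forall i, 0 < f i) -> (forall i, 0 < g i) -> \sum_i f i = \sum_i g i ->
  (forall e : edge d n, f (edge_tail e) * g (edge_head e)
                      = g (edge_tail e) * f (edge_head e)) ->
  forall i, f i = g i.
Proof.
move=> f0 g0 fg_sum prop i.
have cross : forall i j, f i * g j = g i * f j.
  apply: grid_connected => [j|j h k hj jk|e|e]; first by rewrite mulrC.
  - have gj : g j != 0 by rewrite gt_eqF.
    by apply: (mulfI gj); rewrite mulrA [g j * f h]mulrC hj -mulrA jk mulrCA.
  - exact: prop.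
  - by rewrite mulrC -prop mulrC.
have : \sum_j f i * g j = \sum_j g i * f j by apply: eq_bigr => j _.
rewrite -!mulr_sumr -fg_sum => /mulIf; apply; rewrite gt_eqF //.
by rewrite (bigD1 i) //= ltr_pwDl // sumr_ge0 // => j _; apply: ltW.
Qed.

(** If the sum of the edgewise convexity inequalities is an equality, so is
each of them; the two points are then proportional on each edge, and
connectedness and mass one make them equal. *)
Lemma objective_formula_strictly_convex (R : realType) (d n L : nat)
    (p0 p1 : {ffun vertex d n -> R}) (beta t : R) (x y : unknowns R d n L) :
  (0 < n)%N -> 0 < beta -> \sum_i p1 i = 1 ->
  Theta_int p0 p1 x -> Theta_int p0 p1 y -> x <> y -> 0 < t -> t < 1 ->
  objective_formula beta (t *: x + (1 - t) *: y)
    < t * objective_formula beta x + (1 - t) * objective_formula beta y.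
Proof.
move=> n0 beta0 p1_sum [xT x0] [yT y0] xy t0 t1.
have k0 : 0 < beta ^+ 2 / space_step R n ^+ 2.
  by rewrite divr_gt0 ?exprn_gt0 // /space_step invr_gt0 ltr0n.
rewrite !objective_formulaE !mulr_sumr -big_split /=.
have L1 := leif_sum (fun (el : edge d n * 'I_L) (_ : true) =>
  edge_cost_convex (flux x el.1 el.2) (flux y el.1 el.2) k0 t0 t1
   (x0 (edge_tail el.1) el.2) (x0 (edge_head el.1) el.2)
   (y0 (edge_tail el.1) el.2) (y0 (edge_head el.1) el.2)).
under eq_bigr do rewrite flux_conv !density_conv.
rewrite (lt_leif L1); apply/negP => /forallP par; apply: xy.
have dens i l : density x i l = density y i l.
  apply: (density_eq_of_proportional (f := density x ^~ l) (g := density y ^~ l)) => //.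
    by rewrite (mass_density _ p1_sum xT) (mass_density _ p1_sum yT).
  by move=> e; have /andP[/eqP] := par (e, l).
have fl e l : flux x e l = flux y e l.
  have /andP[_ /eqP] := par (e, l); rewrite /= !dens => /mulIf; apply.
  by rewrite gt_eqF ?addr_gt0.
case: x y dens fl {xT x0 yT y0 L1 par} => [mx px] [my py] dens fl.
by congr pair; apply/ffunP => -[? ?]; [exact: fl|exact: dens].
Qed.

(** * A priori bounds on sublevel sets *)

Lemma ler_of_sqr_le (R : realType) (a c : R) : a ^+ 2 <= c -> `|a| <= 1 + c.
Proof. by move=> ac; rewrite ler_norml; apply/andP; split; nra. Qed.

Lemma density_le1 (R : realType) (d n L : nat) (p0 p1 : {ffun vertex d n -> R})
    (x : unknowns R d n L) (i : vertex d n) (l : 'I_L) :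
  \sum_j p1 j = 1 -> Theta p0 p1 x -> density x i l <= 1.
Proof.
move=> p1_sum xT; rewrite -(mass_density l p1_sum xT) (bigD1 i) //= lerDl.
by rewrite sumr_ge0 // => j _; have [] := xT j l.
Qed.

Lemma ex_ge_mean (R : realType) (T : finType) (f : T -> R) :
  \sum_i f i = 1 -> exists i, #|T|%:R^-1 <= f i.
Proof.
move=> f1; apply: contrapT => /forallNP lt_f.
have T0 : (0 < #|T|)%N.
  rewrite lt0n; apply/eqP => T0; have := oner_neq0 R.
  by rewrite -f1 big1 ?eqxx // => i _; have := card0_eq T0 i; rewrite inE.
have /card_gt0P[j _] := T0.
suff : \sum_i f i < \sum_(i : T) #|T|%:R^-1.
  by rewrite f1 sumr_const -[_ *+ _]mulr_natl mulfV ?ltxx // pnatr_eq0 -lt0n.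
apply: ltr_sum; first by apply/hasP; exists j; rewrite ?mem_index_enum.
by move=> i _; rewrite ltNge; apply/negP; apply: lt_f.
Qed.

(** As [p] is at least [c], the squared difference of logarithms is at most
[2 * C / c]; the factor comes from bounding a number by one plus its square. *)
Lemma harnack_edge (R : realType) (C c p q : R) :
  0 < c -> c <= p -> 0 < q -> (ln p - ln q) ^+ 2 * ((p + q) / 2) <= C ->
  c * expR (- (1 + 2 * C / c)) <= q.
Proof.
move=> c0 cp q0 leC; have p0 : 0 < p by apply: lt_le_trans cp.
have sq : (ln p - ln q) ^+ 2 <= 2 * C / c.
  rewrite ler_pdivlMr //; move: leC (sqr_ge0 (ln p - ln q)).
  move: (_ ^+ 2) => S leC S0.
  by have : S * c <= S * (p + q); [rewrite ler_wpM2l //|]; lra.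
have /ler_normlP[_ le_ln] := ler_of_sqr_le sq.
have -> : q = p * expR (- (ln p - ln q)).
  by rewrite opprB expRD expRN !lnK // mulrCA mulfV ?mulr1 // gt_eqF.
by apply: ler_pM; rewrite ?expR_ge0 ?ler_expR ?lerN2 ?(ltW c0).
Qed.

(** Each step along a path lowers the bound by a factor that depends only on
the current bound, so the bound reached at the end of a path does not depend on
the density. *)
Lemma harnack (R : realType) (d n : nat) (C c : R) : 0 < c ->
  exists2 delta : R, 0 < delta & forall p : vertex d n -> R,
    (forall i, 0 < p i) ->
    (forall e : edge d n, (ln (p (edge_tail e)) - ln (p (edge_head e))) ^+ 2
       * ((p (edge_tail e) + p (edge_head e)) / 2) <= C) ->
    (exists i, c <= p i) -> forall j, delta <= p j.
Proof.
move=> c0.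
pose adm (p : vertex d n -> R) := (forall i, 0 < p i) /\
  forall e : edge d n, (ln (p (edge_tail e)) - ln (p (edge_head e))) ^+ 2
       * ((p (edge_tail e) + p (edge_head e)) / 2) <= C.
have along (i j : vertex d n) : forall a : R, 0 < a -> exists b : R, 0 < b /\
    forall p, adm p -> a <= p i -> b <= p j.
  move: i j; apply: grid_connected => [i a a0|j i k ij jk a a0|e a a0|e a a0].
  - by exists a.
  - have [b [b0 Hb]] := ij a a0; have [b' [b'0 Hb']] := jk b b0.
    by exists b'; split=> // p pa ai; apply: Hb' => //; apply: Hb.
  - exists (a * expR (- (1 + 2 * C / a))); rewrite mulr_gt0 ?expR_gt0 //.
    by split=> // p [p0 pC] ap; apply: harnack_edge (pC e).
  - exists (a * expR (- (1 + 2 * C / a))); rewrite mulr_gt0 ?expR_gt0 //.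
    split=> // p [p0 pC] ap; apply: (harnack_edge a0 ap (p0 _)).
    by have := pC e; rewrite -sqrrN opprB [p _ + _]addrC.
have [b bP] := choice (fun ij : vertex d n * vertex d n => along ij.1 ij.2 c c0).
exists (\big[Order.min/1]_ij b ij).
  by apply: lt_bigmin => // ij _; have [] := bP ij.
move=> p p0 pC [i ci] j; apply: le_trans (bigmin_le _ (i, j) _) _.
by have [_] := bP (i, j); apply.
Qed.

(** All edge costs are nonnegative, so each of them is at most the whole
objective. *)
Lemma sublevel_bounds (R : realType) (d n L : nat)
    (p0 p1 : {ffun vertex d n -> R}) (beta C : R) :
  (0 < n)%N -> 0 < beta -> \sum_i p1 i = 1 ->
  exists delta M : R, 0 < delta /\ forall x : unknowns R d n L,
    Theta_int p0 p1 x -> objective_formula beta x <= C ->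
    (forall i l, delta <= density x i l <= 1) /\
    (forall e l, - M <= flux x e l <= M).
Proof.
move=> n0 beta0 p1_sum; pose k := beta ^+ 2 / space_step R n ^+ 2.
have k0 : 0 < k.
  by rewrite divr_gt0 ?exprn_gt0 // /space_step invr_gt0 ltr0n.
have card0 : (0 < #|vertex d n|)%N by apply/card_gt0P; exists [ffun=> ord0].
have N0 : 0 < #|vertex d n|%:R^-1 :> R by rewrite invr_gt0 ltr0n.
have [delta delta0 deltaP] := harnack d n (C / k) N0.
exists delta, (1 + C); split=> // x [xT x0] xC.
have term_le e l :
    edge_cost k (flux x e l) (density x (edge_tail e) l)
                             (density x (edge_head e) l) <= C.
  apply: le_trans xC; rewrite objective_formulaE (bigD1 (e, l)) //= lerDl.
  by apply: sumr_ge0 => el _; apply: edge_cost_ge0 => //; apply: ltW.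
split=> [i l|e l].
  rewrite (density_le1 i l p1_sum xT) andbT.
  apply: (deltaP (density x ^~ l)) => // [e|]; last first.
    exact: ex_ge_mean (mass_density l p1_sum xT).
  rewrite ler_pdivlMr // [leLHS]mulrC (mulrA k).
  apply: le_trans (term_le e l); rewrite /edge_cost lerDr.
  by rewrite divr_ge0 ?sqr_ge0 // divr_ge0 // addr_ge0 // ltW.
rewrite -ler_norml; apply: ler_of_sqr_le; have := term_le e l.
rewrite /edge_cost; set p := density x _ l; set q := density x _ l => le_C.
have p_gt0 : 0 < p by exact: x0.
have q_gt0 : 0 < q by exact: x0.
have p_le1 : p <= 1 by exact: density_le1 p1_sum xT.
have q_le1 : q <= 1 by exact: density_le1 p1_sum xT.
have w0 : 0 < (p + q) / 2 by lra.
have C0 : 0 <= C := le_trans (edge_cost_ge0 _ (ltW k0) p_gt0 q_gt0) le_C.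
have : flux x e l ^+ 2 / ((p + q) / 2) <= C.
  apply: le_trans le_C; rewrite lerDl mulr_ge0 ?(ltW w0) //.
  by rewrite mulr_ge0 ?sqr_ge0 // ltW.
rewrite ler_pdivrMr // => /le_trans; apply.
by rewrite ler_piMr //; lra.
Qed.

(** * Existence of a minimizer *)

Lemma cvg_sumr (R : realType) (T I : Type) (F : set_system T) {FF : Filter F}
    (r : seq I) (u : I -> T -> R) (a : I -> R) :
  (forall i, u i x @[x --> F] --> a i) ->
  \sum_(i <- r) u i x @[x --> F] --> \sum_(i <- r) a i.
Proof.
move=> ua.
have add_c : continuous (fun x : R * R => x.1 + x.2) := @add_continuous R.
exact: (@cvg_big R I +%R 0 xpredT add_c T F r u a FF (fun i _ => ua i)).
Qed.

Lemma cvg_edge_cost (R : realType) (T : Type) (F : set_system T)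
    {FF : Filter F} (k m0 p0 q0 : R) (m p q : T -> R) :
  0 < p0 -> 0 < q0 ->
  m x @[x --> F] --> m0 -> p x @[x --> F] --> p0 -> q x @[x --> F] --> q0 ->
  edge_cost k (m x) (p x) (q x) @[x --> F] --> edge_cost k m0 p0 q0.
Proof.
move=> p0_gt0 q0_gt0 cm cp cq.
have cs : p x + q x @[x --> F] --> p0 + q0 by exact: cvgD.
have cw : (p x + q x) / 2 @[x --> F] --> (p0 + q0) / 2.
  exact: (cvgM cs (cvg_cst (2^-1 : R))).
have clp : ln (p x) @[x --> F] --> ln p0.
  by apply: continuous_cvg cp; exact: continuous_ln.
have clq : ln (q x) @[x --> F] --> ln q0.
  by apply: continuous_cvg cq; exact: continuous_ln.
have w0 : (p0 + q0) / 2 != 0 by rewrite gt_eqF // divr_gt0 // addr_gt0.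
have cd : ln (p x) - ln (q x) @[x --> F] --> ln p0 - ln q0 by exact: cvgB.
have cd2 : (ln (p x) - ln (q x)) ^+ 2 @[x --> F] --> (ln p0 - ln q0) ^+ 2.
  exact: (cvgM cd cd).
have ck : k * (ln (p x) - ln (q x)) ^+ 2 @[x --> F] --> k * (ln p0 - ln q0) ^+ 2.
  exact: (cvgM (cvg_cst k) cd2).
have cm2 : m x ^+ 2 @[x --> F] --> m0 ^+ 2 by exact: (cvgM cm cm).
have cV : ((p x + q x) / 2)^-1 @[x --> F] --> ((p0 + q0) / 2)^-1.
  exact: (cvgV w0 cw).
have cmw : m x ^+ 2 / ((p x + q x) / 2) @[x --> F] --> m0 ^+ 2 / ((p0 + q0) / 2).
  exact: (cvgM cm2 cV).
have ckw : k * (ln (p x) - ln (q x)) ^+ 2 * ((p x + q x) / 2) @[x --> F]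
    --> k * (ln p0 - ln q0) ^+ 2 * ((p0 + q0) / 2) by exact: (cvgM ck cw).
exact: (cvgD cmw ckw).
Qed.

Lemma cvg_residual (R : realType) (T : Type) (F : set_system T)
    {FF : Filter F} (d : nat) (a b : R) (p q : T -> R) (u v : 'I_d -> T -> R)
    (p0 q0 : R) (u0 v0 : 'I_d -> R) :
  p x @[x --> F] --> p0 -> q x @[x --> F] --> q0 ->
  (forall j, u j x @[x --> F] --> u0 j) ->
  (forall j, v j x @[x --> F] --> v0 j) ->
  (p x - q x) / a + b * \sum_j (u j x - v j x) @[x --> F]
    --> (p0 - q0) / a + b * \sum_j (u0 j - v0 j).
Proof.
move=> cp cq cu cv.
have cpq : p x - q x @[x --> F] --> p0 - q0 by exact: cvgB.
have cuv : \sum_j (u j x - v j x) @[x --> F] --> \sum_j (u0 j - v0 j).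
  by apply: cvg_sumr => j; exact: (cvgB (cu j) (cv j)).
have cpqa : (p x - q x) / a @[x --> F] --> (p0 - q0) / a.
  exact: (cvgM cpq (cvg_cst (a^-1 : R))).
have cb : b * \sum_j (u j x - v j x) @[x --> F] --> b * \sum_j (u0 j - v0 j).
  exact: (cvgM (cvg_cst b) cuv).
exact: (cvgD cpqa cb).
Qed.

Section Compactness.
Variables (R : realType) (d n L : nat).

(** The space of unknowns is a bare module over finite functions; its points
are transported to plain functions with the product topology, where products
of segments are compact. *)
Definition coordinates : Type :=
  prod_topology (fun _ : (edge d n * 'I_L) + (vertex d n * 'I_L) => R).

Definition decode (f : coordinates) : unknowns R d n L :=
  ([ffun el => f (inl el)], [ffun il => f (inr il)]).

Definition encode (x : unknowns R d n L) : coordinates := fun s =>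
  match s with inl el => x.1 el | inr il => x.2 il end.

Lemma encodeK : cancel encode decode.
Proof. by case=> m p; congr pair; apply/ffunP => s; rewrite ffunE. Qed.

Lemma flux_decode_continuous e l :
  continuous (fun f : coordinates => flux (decode f) e l).
Proof.
have -> : (fun f => flux (decode f) e l) = proj (inl (e, l)).
  by apply/funext => f; rewrite /flux ffunE.
exact: proj_continuous.
Qed.

Lemma density_decode_continuous i l :
  continuous (fun f : coordinates => density (decode f) i l).
Proof.
have -> : (fun f => density (decode f) i l) = proj (inr (i, l)).
  by apply/funext => f; rewrite /density ffunE.
exact: proj_continuous.
Qed.

Lemma closed_continuity_equation (p0 p1 : {ffun vertex d n -> R}) :
  closed [set f : coordinates | forall i (l : 'I_L),
    (density_at p0 p1 (decode f) i l.+2 - density_at p0 p1 (decode f) i l.+1)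
        / time_step R L
     + (space_step R n)^-1
        * \sum_(v < d) (flux_up (decode f) i v l - flux_down (decode f) i v l) = 0].
Proof.
have cont_at i k : continuous (fun f => density_at p0 p1 (decode f) i k).
  case: k => [|k] /=; first exact: cst_continuous.
  by case: insub => [l|]; [exact: density_decode_continuous|exact: cst_continuous].
have cont_up i v l : continuous (fun f => flux_up (decode f) i v l).
  rewrite /flux_up; case: insub => [e|]; last exact: cst_continuous.
  exact: flux_decode_continuous.
have cont_down i v l : continuous (fun f => flux_down (decode f) i v l).
  rewrite /flux_down; case: (0 < i v)%N; last exact: cst_continuous.
  exact: cont_up.
pose r (il : vertex d n * 'I_L) (f : coordinates) :=
  (density_at p0 p1 (decode f) il.1 il.2.+2
     - density_at p0 p1 (decode f) il.1 il.2.+1) / time_step R L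
  + (space_step R n)^-1 * \sum_(v < d)
      (flux_up (decode f) il.1 v il.2 - flux_down (decode f) il.1 v il.2).
have cont_r il : continuous (r il).
  case: il => i l f.
  exact: (cvg_residual (cont_at i l.+2 f) (cont_at i l.+1 f)
    (fun v => cont_up i v l f) (fun v => cont_down i v l f)).
rewrite (_ : [set _ | _] = \bigcap_il [set f | r il f = 0]).
  apply: closed_bigI => il _.
  exact: (continuous_closedP (r il)).1 (cont_r il) _ (@closed_eq R 0).
by apply/seteqP; split=> [f Hf [i l] _|f Hf i l]; [exact: Hf|exact: (Hf (i, l))].
Qed.

Lemma objective_decode_continuous (beta : R) (f : coordinates) :
  (forall i l, 0 < density (decode f) i l) ->
  {for f, continuous (fun g => objective_formula beta (decode g))}.
Proof.
move=> f0; rewrite (_ : (fun g => _) = (fun g => \sum_(el : edge d n * 'I_L)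
    edge_cost (beta ^+ 2 / space_step R n ^+ 2) (flux (decode g) el.1 el.2)
      (density (decode g) (edge_tail el.1) el.2)
      (density (decode g) (edge_head el.1) el.2))); last first.
  by apply/funext => g; exact: objective_formulaE.
have term el := cvg_edge_cost (k := beta ^+ 2 / space_step R n ^+ 2)
  (f0 (edge_tail el.1) el.2) (f0 (edge_head el.1) el.2)
  (@flux_decode_continuous el.1 el.2 f)
  (@density_decode_continuous (edge_tail el.1) el.2 f)
  (@density_decode_continuous (edge_head el.1) el.2 f).
exact: (cvg_sumr (term (nbhs_filter f))).
Qed.

(** Densities are kept away from zero here, so that the objective is continuous
on this set. *)
Definition feasible_box (p0 p1 : {ffun vertex d n -> R}) (delta M : R) :
    set coordinates :=
  [set f | [/\ forall i l, delta <= density (decode f) i l <= 1,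
                forall e l, - M <= flux (decode f) e l <= M &
                Theta p0 p1 (decode f)]].

Lemma compact_feasible_box (p0 p1 : {ffun vertex d n -> R}) (delta M : R) :
  0 < delta -> compact (feasible_box p0 p1 delta M).
Proof.
move=> delta0.
pose A (s : (edge d n * 'I_L) + (vertex d n * 'I_L)) : set R :=
  if s is inl _ then `[- M, M]%classic else `[delta, 1]%classic.
have A_compact s : compact (A s) by case: s => ?; exact: segment_compact.
have := compact_closedI (tychonoff A_compact) (@closed_continuity_equation p0 p1).
congr compact; apply/seteqP; split=> f /=.
  move=> [fA eqf]; have dens i l : delta <= density (decode f) i l <= 1.
    by have := fA (inr (i, l)); rewrite /A /density ffunE /= in_itv.
  split=> // [e l|i l].
    by have := fA (inl (e, l)); rewrite /A /flux ffunE /= in_itv.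
  split; last exact: eqf.
  by have /andP[+ _] := dens i l; apply/le_trans/ltW.
move=> [dens fl fT]; split=> [[[e l]|[i l]]|i l].
- by have := fl e l; rewrite /A /flux ffunE /= in_itv.
- by have := dens i l; rewrite /A /density ffunE /= in_itv.
- by have [] := fT i l.
Qed.

End Compactness.

(** A feasible competitor: the continuity equation leaves the density at the
first time free, so the density may equal [p1] at all times. *)
Definition stationary (R : realType) (d n L : nat)
    (p : {ffun vertex d n -> R}) : unknowns R d n L :=
  (0, [ffun il => p il.1]).

Lemma stationary_feasible (R : realType) (d n L : nat)
    (p0 p1 : {ffun vertex d n -> R}) :
  (forall i, 0 < p1 i) -> Theta_int p0 p1 (stationary L p1).
Proof.
move=> p1_gt0.
have dens i l : density (stationary L p1) i l = p1 i by rewrite /density ffunE.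
have up i v l : flux_up (stationary L p1) i v l = 0.
  by rewrite /flux_up; case: insub => // e; rewrite /flux ffunE.
split=> i l; rewrite dens //; split; first exact: ltW.
rewrite big1 => [|v _]; last by rewrite /flux_down !up if_same subrr.
have at1 k : density_at p0 p1 (stationary L p1) i k.+1 = p1 i.
  by rewrite /=; case: insub.
by rewrite !at1 subrr mul0r mulr0 addr0.
Qed.

(** The minimum over the compact box is a minimum over the whole interior,
since points outside the box have a larger objective than the stationary
competitor, which is in the box. *)
Lemma minimizer_exists (R : realType) (d n L : nat)
    (p0 p1 : {ffun vertex d n -> R}) (beta : R) :
  (0 < n)%N -> 0 < beta -> prob_simplex_int p1 ->
  exists2 x : unknowns R d n L, Theta_int p0 p1 x &
    forall y : unknowns R d n L, Theta_int p0 p1 y ->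
      objective_formula beta x <= objective_formula beta y.
Proof.
move=> n0 beta0 [[p1_sum _] p1_gt0].
have z_int := stationary_feasible L p0 p1_gt0.
set z := stationary L p1 in z_int.
have [delta [M [delta0 bounds]]] :=
  @sublevel_bounds R d n L p0 p1 beta (objective_formula beta z) n0 beta0 p1_sum.
pose K : set (coordinates R d n L) := feasible_box p0 p1 delta M.
have inK y : Theta_int p0 p1 y ->
    objective_formula beta y <= objective_formula beta z -> K (encode y).
  move=> y_int yz; rewrite /K /feasible_box /= encodeK.
  by have [? ?] := bounds y y_int yz; case: y_int.
have K_gt0 f : K f -> forall i l, 0 < density (decode f) i l.
  by move=> [dens _ _] i l; have /andP[+ _] := dens i l; exact: lt_le_trans.
have [||c cK c_min] := compact_EVT_min (f := fun f => objective_formula beta (decode f))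
  _ (@compact_feasible_box R d n L p0 p1 delta M delta0).
- by exists (encode z); exact: inK.
- apply: continuous_in_subspaceT => f; rewrite inE => fK.
  by apply: objective_decode_continuous; exact: K_gt0.
rewrite inE in cK.
have c_le (y : unknowns R d n L) : Theta_int p0 p1 y ->
    objective_formula beta y <= objective_formula beta z ->
    objective_formula beta (decode c) <= objective_formula beta y.
  move=> y_int yz; have := c_min (encode y); rewrite inE /= encodeK; apply.
  exact: inK.
exists (decode c); first by split; [case: cK|exact: K_gt0].
move=> y y_int.
have [yz|/ltW zy] := leP (objective_formula beta y) (objective_formula beta z).
  exact: c_le.
exact: le_trans (c_le z z_int (lexx _)) zy.
Qed.

Theorem theorem1 (R : realType) (d n L : nat)
    (d_ge1 : (1 <= d)%N) (n_ge1 : (1 <= n)%N) (L_ge1 : (1 <= L)%N)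
    (p0 p1 : {ffun vertex d n -> R})
    (p0_int : prob_simplex_int p0) (p1_int : prob_simplex_int p1)
    (beta : R) (beta_gt0 : 0 < beta) :
  strictly_convex_on (@Theta_int R d n L p0 p1) (objective beta) /\
  exists x : unknowns R d n L,
    Theta_int p0 p1 x /\
    unique (minimizer_on (Theta p0 p1) (objective beta)) x.
Proof.
have p1_sum : \sum_i p1 i = 1 by case: p1_int => -[].
have strict (x y : unknowns R d n L) t := @objective_formula_strictly_convex
  R d n L p0 p1 beta t x y n_ge1 beta_gt0 p1_sum.
split.
  split; first exact: convex_Theta_int.
  move=> x y t x_int y_int xy t0 t1.
  have t01 : 0 <= t <= 1 by rewrite !ltW.
  have [_ z0] := Theta_int_conv t01 x_int y_int.
  rewrite !objective_int //; [|by case: y_int|by case: x_int].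
  by rewrite -!EFinM -EFinD lte_fin; apply: strict.
have [x x_int x_min] := minimizer_exists L p0 n_ge1 beta_gt0 p1_int.
have objE (y : unknowns R d n L) :
    Theta_int p0 p1 y -> objective beta y = (objective_formula beta y)%:E.
  by case=> _; exact: objective_int.
exists x; split=> //; split.
  split; first by case: x_int.
  move=> y yT; rewrite (objE x x_int) /objective; case: ifPn => [/forallP y0|_].
    rewrite lee_fin; apply: x_min; split=> // i l.
    by have /forallP := y0 i; apply.
  exact: leey.
move=> y [yT y_min].
have y_int : Theta_int p0 p1 y.
  split=> // i l; have := y_min x x_int.1.
  rewrite (objE x x_int) /objective; case: ifPn => [/forallP y0 _|_].
    by have /forallP := y0 i; apply.
  by rewrite leye_eq.
have yx : objective_formula beta y <= objective_formula beta x.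
  by rewrite -lee_fin -!objE //; apply: y_min; case: x_int.
apply: contrapT => xy.
have h0 : 0 < 2^-1 :> R by rewrite invr_gt0.
have h1 : 2^-1 < 1 :> R by rewrite invf_lt1 ?ltr1n.
have h01 : 0 <= (2^-1 : R) <= 1 by rewrite !ltW.
have := strict x y 2^-1 x_int y_int xy h0 h1.
have := x_min _ (Theta_int_conv h01 x_int y_int); lra.
Qed.
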